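(* Let $n\ge 1$ and $m\ge 1$ be integers and let $H_m(\mathbb B)$ be the analytic functional Hilbert space on the open unit ball $\mathbb B\subset\mathbb C^n$ with reproducing kernel $K_m(z,w)=(1-\langle z,w\rangle)^{-m}$. Let $r\in\mathbb N$ and let $T\in L(H_m(\mathbb B))$ be homogeneous of degree $r$ (i.e. $T\mathbb H_j\subset\mathbb H_{j+r}$ for all $j\ge 0$) and satisfy \[ M^{\prime *}_zTM^\prime_z = P_{{\rm Im}M^*_z}\Big(\oplus \sum^{m-1}_{j=0}(-1)^j\binom{m}{j+1}\sigma^j_{M_z}(T)\Big)P_{{\rm Im}M^*_z}. \] Then $Tf=(T1)f$ for all $f\in H_m(\mathbb B)$.
   Context: $H_m(\mathbb B)=\{f=\sum_{\alpha\in\mathbb N^n}f_\alpha z^\alpha\in\mathcal O(\mathbb B):\ \|f\|^2=\sum_\alpha |f_\alpha|^2/\rho_m(\alpha)<\infty\}$ with $\rho_m(\alpha)=\frac{(m+|\alpha|-1)!}{\alpha!(m-1)!}$. Let $\mathbb H_k$ denote the space of homogeneous polynomials of degree $k$, so $H_m(\mathbb B)$ is the orthogonal sum of the $\mathbb H_k$, and every $f$ has homogeneous expansion $f=\sum_k f_k$, $f_k\in\mathbb H_k$. $M_z:H_m(\mathbb B)^n\to H_m(\mathbb B)$, $(f_i)\mapsto\sum_i z_if_i$, is the row multiplication operator (it has closed range), $M_z^*:H_m(\mathbb B)\to H_m(\mathbb B)^n$, $f\mapsto (M_{z_i}^*f)_i$, is its adjoint, and $P_{{\rm Im}M_z^*}$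 is the orthogonal projection of $H_m(\mathbb B)^n$ onto the closed range of $M_z^*$. Let $\delta\in L(H_m(\mathbb B))$ be the diagonal operator $\delta(\sum_k f_k)=f_0+\sum_{k\ge1}\frac{m+k-1}{k}f_k$, and define $M_z'=\delta M_z:H_m(\mathbb B)^n\to H_m(\mathbb B)$, with adjoint $M_z'^*$. For $X\in L(H_m(\mathbb B))$, $\sigma_{M_z}(X)=\sum_{i=1}^n M_{z_i}XM_{z_i}^*$, $\sigma^j_{M_z}$ is its $j$-th iterate ($\sigma^0_{M_z}(X)=X$), and $\oplus X$ denotes $X\oplus\cdots\oplus X$ ($n$ copies) on $H_m(\mathbb B)^n$. *)

(* Defs.v *)
From HB Require Import structures.
From mathcomp Require Import all_boot all_order all_algebra.
From mathcomp Require Import all_classical all_reals.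
From mathcomp Require Import ereal esum.
From mathcomp Require complex.
Import complex.ComplexEqChoice complex.ComplexField.

Set Implicit Arguments.
Unset Strict Implicit.
Unset Printing Implicit Defensive.

Import Order.TTheory GRing.Theory Num.Theory.
Local Open Scope ring_scope.

Section Hm.
Variables (R : realType) (n m : nat).

Local Notation C := (complex.complex R).
Definition ci : C := complex.Complex 0 1.

Definition mi := {ffun 'I_n -> nat}.
Definition deg (a : mi) : nat := (\sum_(i < n) a i)%N.
Definition mfact (a : mi) : nat := (\prod_(i < n) (a i)`!)%N.

Definition rho (a : mi) : R :=
  ((m + deg a - 1)`!)%:R / ((mfact a * (m - 1)`!)%N)%:R.

(* an element of H_m(B) is represented by its Taylor coefficient family *)
Definition fn := mi -> C.

Definition abs2 (z : C) : R := complex.Re z ^+ 2 + complex.Im z ^+ 2.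

Definition wsum (f : fn) : \bar R :=
  (\esum_(a in [set: mi]) (abs2 (f a) / rho a)%:E)%E.

Definition inH (f : fn) : Prop := (wsum f < +oo)%E.

Definition normsq (f : fn) : R := fine (wsum f).

Definition addf (f g : fn) : fn := fun a => f a + g a.
Definition scalef (c : C) (f : fn) : fn := fun a => c * f a.

Definition Cof (x : R) : C := complex.Complex x 0.

(* inner product, linear in the first variable, by polarization from the norm *)
Definition ip (f g : fn) : C :=
  (Cof 4)^-1 * \sum_(k < 4) ci ^+ k * Cof (normsq (addf f (scalef (ci ^+ k) g))).

Definition inHn (F : 'I_n -> fn) : Prop := forall i, inH (F i).
Definition ipn (F G : 'I_n -> fn) : C := \sum_(i < n) ip (F i) (G i).

Definition isOp (A : fn -> fn) : Prop :=
  [/\ forall f, inH f -> inH (A f),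
      forall c f g, inH f -> inH g ->
        A (addf (scalef c f) g) = addf (scalef c (A f)) (A g)
    & exists K : R, forall f, inH f -> normsq (A f) <= K * normsq f].

Definition homog (k : nat) (f : fn) : Prop := forall a, deg a != k -> f a = 0.

Definition dec (i : 'I_n) (a : mi) : mi :=
  [ffun j => if j == i then (a j).-1 else a j].

Definition Mzi (i : 'I_n) (f : fn) : fn :=
  fun a => if (0 < a i)%N then f (dec i a) else 0.

Definition Mz (F : 'I_n -> fn) : fn := fun a => \sum_(i < n) Mzi i (F i) a.

Definition delta (f : fn) : fn :=
  fun a => if deg a == 0%N then f a
           else Cof ((m + deg a - 1)%:R / (deg a)%:R) * f a.

Definition Mz' (F : 'I_n -> fn) : fn := delta (Mz F).

Definition onefn : fn := fun a => if deg a == 0%N then 1 else 0.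

Definition cprod (g f : fn) : fn := fun a =>
  \sum_(b : {ffun 'I_n -> 'I_(deg a).+1} | [forall i, (b i <= a i)%N])
     g [ffun i => (val (b i))] * f [ffun i => (a i - b i)%N].

(* sigma_{M_z}(X) = sum_i M_{z_i} X M_{z_i}^*, given the adjoints Ms i *)
Definition sigma (Ms : 'I_n -> fn -> fn) (X : fn -> fn) : fn -> fn :=
  fun f a => \sum_(i < n) Mzi i (X (Ms i f)) a.

Definition Sop (Ms : 'I_n -> fn -> fn) (T : fn -> fn) : fn -> fn :=
  fun f a => \sum_(j < m) ((-1) ^+ j * ('C(m, j.+1))%:R) * iter j (sigma Ms) T f a.

Definition is_adj_Mzi (Ms : 'I_n -> fn -> fn) : Prop :=
  forall i, (forall g, inH g -> inH (Ms i g)) /\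
    (forall f g, inH f -> inH g -> ip (Mzi i f) g = ip f (Ms i g)).

Definition is_adj_Mz' (Mps : fn -> 'I_n -> fn) : Prop :=
  (forall g, inH g -> inHn (Mps g)) /\
  (forall F g, inHn F -> inH g -> ip (Mz' F) g = ipn F (Mps g)).

(* P is the orthogonal projection of H^n onto Im M_z^* (a closed subspace),
   where M_z^* g = (M_{z_i}^* g)_i *)
Definition is_projImMzs (Ms : 'I_n -> fn -> fn) (P : ('I_n -> fn) -> 'I_n -> fn)
  : Prop :=
  forall F, inHn F ->
    [/\ inHn (P F),
        exists2 g, inH g & P F = (fun i => Ms i g)
      & forall g, inH g ->
          ipn (fun i => addf (F i) (scalef (-1) (P F i))) (fun i => Ms i g) = 0].

End Hm.

(* Main.v *)
Require Import Defs.
From HB Require Import structures.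
From mathcomp Require Import all_boot all_order all_algebra.
From mathcomp Require Import all_classical all_reals.
From mathcomp Require Import ereal esum.
From mathcomp Require Import complex.
From mathcomp Require Import ring lra zify.
Import complex.ComplexField.

Set Implicit Arguments.
Unset Strict Implicit.
Unset Printing Implicit Defensive.

Import Order.TTheory GRing.Theory Num.Theory.

(* On coefficients, M_{z_i}^* acts by g |-> (rho b / rho (b + e_i)) g_{b + e_i},
   so M_z M_z^* multiplies the degree-k part by k / (m + k - 1), i.e. delta inverts
   M_z M_z^* in positive degree.  Applying both sides of the identity to M_z^* f and
   then M_z to the result (P is absorbed) gives, at every multi-index of positive
   degree,
     sum_{j <= m} (-1)^j C(m, j) sigma^j(T) f = f_0 T1.
   Multiplication by g = T1 satisfies the same equation, because sigma^j commutes
   with it and sum_j (-1)^j C(m, j) sigma^j(id) is the projection onto constants.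
   The terms with j >= 1 only involve output coefficients of smaller degree, so T
   and multiplication by g agree by induction on the degree of the output
   coefficient.  The induction starts in degree 0, where homogeneity and
   boundedness of T show that the constant term of T f depends only on f_0. *)

(** * Multi-indices and the shift of one exponent *)

Section MultiIndex.
Variables (n : nat).
Implicit Types (i : 'I_n) (a b : mi n).

Definition inc i b : mi n := [ffun j => (b j + (j == i))%N].

Lemma deg_inc i b : deg (inc i b) = (deg b).+1.
Proof.
rewrite /deg (bigD1 i) //= [in RHS](bigD1 i) //= ffunE eqxx addn1 addSn.
by congr (_ + _).+1; apply: eq_bigr => j ji; rewrite ffunE (negPf ji) addn0.
Qed.

Lemma dec_inc i b : dec i (inc i b) = b.
Proof.
by apply/ffunP => j; rewrite !ffunE; case: eqP => [->|_]; rewrite ?addn1 ?addn0.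
Qed.

Lemma inc_dec i a : (0 < a i)%N -> inc i (dec i a) = a.
Proof.
move=> ai; apply/ffunP => j; rewrite !ffunE; case: eqP => [->|_]; last by rewrite addn0.
by rewrite addn1 prednK.
Qed.

Lemma inc_gt0 i b : (0 < inc i b i)%N.
Proof. by rewrite ffunE eqxx addn1. Qed.

Lemma inc_inj i : injective (inc i).
Proof. by apply: can_inj (dec_inc i). Qed.

Lemma deg_dec i a : (0 < a i)%N -> (deg (dec i a)).+1 = deg a.
Proof. by move=> ai; rewrite -(deg_inc i) inc_dec. Qed.

Lemma deg_eq0 a : deg a = 0%N -> a = [ffun=> 0%N].
Proof.
move/eqP; rewrite sum_nat_eq0 => /forallP a0.
by apply/ffunP => i; rewrite ffunE; apply/eqP/a0.
Qed.

Lemma leq_deg a i : (a i <= deg a)%N.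
Proof. by rewrite /deg (bigD1 i) //= leq_addr. Qed.

End MultiIndex.

Section Space.
Variables (R : realType) (n m : nat).
Hypothesis hm : (1 <= m)%N.
Local Open Scope ring_scope.
Local Notation C := (complex.complex R).
Local Notation conj := (@complex.conjc R).
Local Notation rho := (@rho R n m).
(* mathcomp's fraction.v also exports an addf *)
Local Notation addf := (@Defs.addf R n).
Implicit Types (f g h : fn R n) (a b : mi n) (i : 'I_n) (x y z : C).

(** * Weights and their ratio along a shift *)

Lemma mfact_inc i b : mfact (inc i b) = ((b i).+1 * mfact b)%N.
Proof.
rewrite /mfact (bigD1 i) //= [in RHS](bigD1 i) //= ffunE eqxx addn1 factS mulnA.
by congr (_ * _)%N; apply: eq_bigr => j ji; rewrite ffunE (negPf ji) addn0.
Qed.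

Lemma rho_gt0 a : 0 < rho a.
Proof.
rewrite divr_gt0 ?ltr0n ?fact_gt0 // muln_gt0 fact_gt0 andbT.
by apply: prodn_gt0 => i; exact: fact_gt0.
Qed.

Lemma rho_neq0 a : rho a != 0.
Proof. by rewrite gt_eqF ?rho_gt0. Qed.

(** The squared norm of z^(b + e_i) over that of z^b: the weight of M_{z_i}^* as a backward shift.
    Being at most 1, it also makes M_{z_i} a contraction. *)
Lemma rho_inc i b : rho b / rho (inc i b) = (b i).+1%:R / (m + deg b)%:R.
Proof.
rewrite /Defs.rho mfact_inc deg_inc.
have -> : (m + (deg b).+1 - 1 = (m + deg b - 1).+1)%N by lia.
have := hm; have -> : (m + deg b = (m + deg b - 1).+1)%N by lia.
move=> _; rewrite subn1 /= factS !natrM.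
have mb0 : (mfact b)%:R != 0 :> R.
  by rewrite pnatr_eq0 -lt0n; apply: prodn_gt0 => k; exact: fact_gt0.
have f0 k : (k`!)%:R != 0 :> R by rewrite pnatr_eq0 -lt0n fact_gt0.
by field; rewrite !nat1r !f0 mb0 !pnatr_eq0.
Qed.

(** * Squared modulus, polarization and the embedding of the reals *)

Lemma abs2_ge0 z : 0 <= abs2 z.
Proof. by rewrite addr_ge0 ?sqr_ge0. Qed.

Lemma abs2_eq0 z : abs2 z = 0 -> z = 0.
Proof.
case: z => x y /eqP; rewrite paddr_eq0 ?sqr_ge0 // !sqrf_eq0 /=.
by move=> /andP[/eqP -> /eqP ->].
Qed.

Lemma abs2M x y : abs2 (x * y) = abs2 x * abs2 y.
Proof. by case: x y => [a b] [c d]; rewrite /abs2 /=; ring. Qed.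

Lemma abs2_0 : abs2 (0 : C) = 0.
Proof. by rewrite /abs2 /= expr0n addr0. Qed.

Lemma abs2D x y : abs2 (x + y) <= 2 * abs2 x + 2 * abs2 y.
Proof.
case: x y => [a b] [c d]; rewrite /abs2 /=.
by have := sqr_ge0 (a - c); have := sqr_ge0 (b - d); nra.
Qed.

(** Expanding the squares leaves x conj(y) in every summand; all other terms carry a factor i^k or
    i^(2k), and these sum to 0. *)
Lemma sum_polarization x y :
  \sum_(k < 4) ci R ^+ k * Cof (abs2 (x + ci R ^+ k * y)) = Cof 4 * (x * conj y).
Proof.
rewrite !big_ord_recl big_ord0 !exprS !expr0 /=.
case: x y => [a b] [c d]; rewrite /abs2 /ci /Cof; apply/eqP.
by rewrite eq_complex /=; apply/andP; split; apply/eqP; ring.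
Qed.

(** The fourth roots of unity sum to 0, so any part of the norm that does not depend on [k] drops
    out of [ip]. *)
Lemma sum_ci_cst (c : R) : \sum_(k < 4) ci R ^+ k * Cof c = 0.
Proof.
rewrite !big_ord_recl big_ord0 !exprS !expr0 /= /ci /Cof; apply/eqP.
by rewrite eq_complex /=; apply/andP; split; apply/eqP; ring.
Qed.

Lemma CofD (x y : R) : Cof (x + y) = Cof x + Cof y.
Proof. by rewrite /Cof; apply/eqP; rewrite eq_complex /= addr0 !eqxx. Qed.

Lemma CofM (x y : R) : Cof (x * y) = Cof x * Cof y.
Proof.
by apply/eqP; rewrite eq_complex /=; apply/andP; split; apply/eqP; ring.
Qed.

Lemma Cof_nat (k : nat) : Cof (k%:R : R) = k%:R.
Proof.
elim: k => [|k IH]; first by [].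
by rewrite -addn1 !natrD CofD IH.
Qed.

Lemma Cof_eq0 (x : R) : (Cof x == 0) = (x == 0).
Proof. by rewrite eq_complex /= eqxx andbT. Qed.

Lemma CofV (x : R) : Cof x^-1 = (Cof x)^-1.
Proof.
have [->|x0] := eqVneq x 0; first by rewrite -[Cof 0]/(0 : C) !invr0.
have Cx0 : Cof x != 0 by rewrite Cof_eq0.
by apply: (mulfI Cx0); rewrite -CofM !divff.
Qed.

(** * Square-summable coefficient families form a vector space *)

Lemma term_ge0 f a : (0 <= (abs2 (f a) / rho a)%:E)%E.
Proof. by rewrite lee_fin divr_ge0 ?abs2_ge0 // ltW ?rho_gt0. Qed.

Lemma wsum_ge0 f : (0 <= wsum m f)%E.
Proof. by apply: esum_ge0 => a _; exact: term_ge0. Qed.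

Lemma wsumE f : inH m f -> wsum m f = (normsq m f)%:E.
Proof. by move=> Hf; rewrite fineK // ge0_fin_numE ?wsum_ge0. Qed.

Lemma normsq_ge0 f : 0 <= normsq m f.
Proof. by rewrite fine_ge0 ?wsum_ge0. Qed.

Lemma esumZ (K : R) (u : mi n -> R) : 0 <= K -> (forall a, 0 <= u a) ->
  (\esum_(a in [set: mi n]) (u a)%:E < +oo)%E ->
  (\esum_(a in [set: mi n]) (K * u a)%:E < +oo)%E.
Proof.
move=> K0 u0 fin; set s := esum _ _ in fin.
have sfin : s \is a fin_num.
  by rewrite ge0_fin_numE //; apply: esum_ge0 => a _; rewrite lee_fin.
apply: (@le_lt_trans _ _ (K%:E * s)%E); last first.
  by rewrite -(fineK sfin) -EFinM ltry.
apply: ge_ereal_sup => _ [A [finA subA] <-].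
under eq_fsbigr do rewrite EFinM.
rewrite -ge0_mule_fsumr; last by move=> a; rewrite lee_fin.
apply: lee_wpmul2l; first by rewrite lee_fin.
by apply: ereal_sup_ubound; exists A.
Qed.

(** Comparison test, behind stability under scaling, deletion of a coefficient and [delta]. *)
Lemma le_inH (K : R) f g : 0 <= K ->
  (forall a, abs2 (g a) <= K * abs2 (f a)) -> inH m f -> inH m g.
Proof.
move=> K0 le_gf Hf.
have u0 a : 0 <= abs2 (f a) / rho a by rewrite divr_ge0 ?abs2_ge0 // ltW ?rho_gt0.
apply: le_lt_trans (esumZ K0 u0 Hf).
apply: le_esum => a _; rewrite lee_fin mulrA ler_wpM2r //.
by rewrite invr_ge0 ltW ?rho_gt0.
Qed.

Lemma inH_scale c f : inH m f -> inH m (scalef c f).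
Proof. by apply: (le_inH (abs2_ge0 c)) => a; rewrite abs2M. Qed.

Lemma inH_add f g : inH m f -> inH m g -> inH m (addf f g).
Proof.
move=> Hf Hg.
have u0 h a : 0 <= abs2 (h a) / rho a.
  by rewrite divr_ge0 ?abs2_ge0 // ltW ?rho_gt0.
have two0 : (0 : R) <= 2 by [].
have := lte_add_pinfty (esumZ two0 (u0 f) Hf) (esumZ two0 (u0 g) Hg).
rewrite -esumD; [|by move=> a _; rewrite lee_fin mulr_ge0..].
apply: le_lt_trans; apply: le_esum => a _; rewrite -EFinD lee_fin !mulrA -mulrDl.
by rewrite ler_wpM2r ?abs2D // invr_ge0 ltW ?rho_gt0.
Qed.

Lemma inH0 : inH m ((fun=> 0) : fn R n).
Proof. by rewrite /inH /wsum esum1 ?ltry // => a _; rewrite abs2_0 mul0r. Qed.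

Lemma inH_sum (I : Type) (s : seq I) (F : I -> fn R n) :
  (forall k, inH m (F k)) -> inH m (fun a => \sum_(k <- s) F k a).
Proof.
move=> HF; elim: s => [|k s IH].
  suff -> : (fun a => \sum_(k <- [::]) F k a) = (fun=> 0) by exact: inH0.
  by apply/funext => a; rewrite big_nil.
rewrite (_ : (fun _ => _) = addf (F k) (fun a => \sum_(k <- s) F k a)).
  exact: inH_add.
by apply/funext => a; rewrite big_cons.
Qed.

(** * Monomials, deletion of a coefficient, inner products with monomials *)

Definition mono b c : fn R n := fun a => if a == b then c else 0.
Definition zer b f : fn R n := fun a => if a == b then 0 else f a.

(** Pythagoras for the splitting of [f] at one monomial: off [b] the two sums have the same
    terms. *)
Lemma wsum_zer b f : wsum m f = ((abs2 (f b) / rho b)%:E + wsum m (zer b f))%E.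
Proof.
rewrite /wsum (esumID [set b]); last by move=> a _; exact: term_ge0.
rewrite setTI esum_set1 ?term_ge0 //; congr (_ + _)%E.
rewrite setTI [RHS](esumID [set b]); last by move=> a _; exact: term_ge0.
rewrite !setTI esum_set1 ?term_ge0 // /zer eqxx abs2_0 mul0r add0e.
by apply: eq_esum => a /= /eqP/negPf ->.
Qed.

Lemma inH_zer b f : inH m f -> inH m (zer b f).
Proof.
apply: (@le_inH 1) => // a; rewrite mul1r /zer; case: ifP => // _.
by rewrite abs2_0 abs2_ge0.
Qed.

Lemma normsq_zer b f : inH m f -> normsq m f = abs2 (f b) / rho b + normsq m (zer b f).
Proof.
move=> Hf; apply: EFin_inj.
by rewrite -wsumE // (wsum_zer b) wsumE ?EFinD //; exact: inH_zer.
Qed.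

Lemma inH_mono b c : inH m (mono b c).
Proof.
rewrite /inH (wsum_zer b) (_ : zer b _ = fun=> 0).
  by apply: lte_add_pinfty; rewrite ?ltry //; exact: inH0.
by apply/funext => a; rewrite /zer /mono; case: eqP.
Qed.

(** Meant for the case where one argument is supported at [b]: what lies off [b] then has a norm
    independent of [k] and is killed by the weights i^k. *)
Lemma ip_polarization b f g s : inH m f -> inH m g ->
  (forall k, normsq m (zer b (addf f (scalef (ci R ^+ k) g))) = s) ->
  ip m f g = f b * conj (g b) / Cof (rho b).
Proof.
move=> Hf Hg cst; rewrite /ip.
have Hk k : inH m (addf f (scalef (ci R ^+ k) g)) by exact/inH_add/inH_scale.
under eq_bigr => k _.
  rewrite (normsq_zer b (Hk k)) cst CofD mulrDr CofM mulrA /Defs.addf /scalef.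
  over.
rewrite big_split /= sum_ci_cst addr0 -mulr_suml sum_polarization CofV.
by rewrite !mulrA mulVf ?mul1r // Cof_eq0 pnatr_eq0.
Qed.

Lemma ci_unit k : abs2 (ci R ^+ k) = 1.
Proof.
elim: k => [|k IH]; rewrite ?exprS ?abs2M ?IH /abs2 /=.
  by rewrite expr1n expr0n addr0.
by rewrite expr1n expr0n add0r mulr1.
Qed.

Lemma normsq_unit k f : normsq m (scalef (ci R ^+ k) f) = normsq m f.
Proof. by congr fine; apply: eq_esum => a _; rewrite /scalef abs2M ci_unit mul1r. Qed.

Lemma ip_monol b c g : inH m g -> ip m (mono b c) g = c * conj (g b) / Cof (rho b).
Proof.
move=> Hg; rewrite (@ip_polarization b _ _ (normsq m (zer b g)) _ Hg);
  first by rewrite /mono eqxx.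
- exact: inH_mono.
move=> k; rewrite -[RHS](normsq_unit k); congr normsq; apply/funext => a.
by rewrite /scalef /zer /Defs.addf /mono /=; case: eqP; rewrite ?mulr0 ?add0r.
Qed.

Lemma ip_monor b c f : inH m f -> ip m f (mono b c) = f b * conj c / Cof (rho b).
Proof.
move=> Hf; rewrite (@ip_polarization b _ _ (normsq m (zer b f)) Hf);
  first by rewrite /mono eqxx.
- exact: inH_mono.
move=> k; congr normsq; apply/funext => a.
by rewrite /zer /Defs.addf /scalef /mono; case: eqP; rewrite ?mulr0 ?addr0.
Qed.

Lemma ip0l g : ip m ((fun=> 0) : fn R n) g = 0.
Proof.
rewrite /ip; under eq_bigr => k _.
  rewrite (_ : addf _ _ = scalef (ci R ^+ k) g) ?normsq_unit; first over.
  by apply/funext => a; rewrite /Defs.addf add0r.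
by rewrite sum_ci_cst mulr0.
Qed.

Lemma ip0r f : ip m f ((fun=> 0) : fn R n) = 0.
Proof.
rewrite /ip; under eq_bigr => k _.
  rewrite (_ : addf _ _ = f); first over.
  by apply/funext => a; rewrite /Defs.addf /scalef mulr0 addr0.
by rewrite sum_ci_cst mulr0.
Qed.

(** * Stability of the space under M_{z_i} and [delta] *)

Lemma inH_Mzi i f : inH m f -> inH m (Mzi i f).
Proof.
rewrite /inH /wsum => Hf; apply: le_lt_trans Hf.
(* Only indices with a_i > 0 contribute. They are the image of [inc i], along which 1 / rho does not
   increase. *)
rewrite (esumID [set a : mi n | (0 < a i)%N]); last by move=> a _; exact: term_ge0.
rewrite !setTI [X in (_ + X)%E]esum1 ?adde0; last first.
  by move=> a /= /negP/negPf ai; rewrite /Mzi ai abs2_0 mul0r.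
rewrite (@reindex_esum R _ _ setT _ (inc i)).
- apply: le_esum => b _; rewrite lee_fin /Mzi inc_gt0 dec_inc.
  rewrite ler_wpM2l ?abs2_ge0 // lef_pV2 ?posrE ?rho_gt0 //.
  rewrite -[leRHS]mul1r -ler_pdivrMr ?rho_gt0 // rho_inc.
  rewrite ler_pdivrMr ?ltr0n ?addn_gt0 ?hm // mul1r ler_nat.
  by have := leq_deg b i; lia.
- split.
  + by move=> b _; exact: inc_gt0.
  + by move=> b b' _ _ /inc_inj.
  + by move=> a /= ai; exists (dec i a) => //; rewrite inc_dec.
Qed.

Definition delta_coef (k : nat) : R := if k == 0%N then 1 else (m + k - 1)%:R / k%:R.

Lemma deltaE f a : delta m f a = Cof (delta_coef (deg a)) * f a.
Proof.
by rewrite /delta /delta_coef; case: ifP => // _; rewrite -[Cof 1]/(1 : C) mul1r.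
Qed.

(** For k >= 1 the upper bound is (m - 1)(k - 1) >= 0. *)
Lemma delta_coef_bound k : 0 <= delta_coef k <= m%:R.
Proof.
rewrite /delta_coef; case: k => [|k] /=; first by rewrite ler01 ler1n.
rewrite divr_ge0 //= ler_pdivrMr ?ltr0n // -natrM ler_nat; nia.
Qed.

Lemma inH_delta f : inH m f -> inH m (delta m f).
Proof.
apply: (@le_inH (m%:R ^+ 2)); first exact: sqr_ge0.
move=> a; rewrite deltaE abs2M ler_wpM2r ?abs2_ge0 //.
have /andP[d0 dm] := delta_coef_bound (deg a).
by rewrite /abs2 /= expr0n addr0 lerXn2r ?nnegrE.
Qed.

Lemma conj_Cof (x : R) : conj (Cof x) = Cof x.
Proof. exact: conjc_real. Qed.

Lemma conjM x y : conj (x * y) = conj x * conj y.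
Proof. exact: rmorphM. Qed.

Lemma Mzi_mono i b c : Mzi i (mono b c) = mono (inc i b) c.
Proof.
apply/funext => a; rewrite /Mzi /mono; case: ifP => [ai|ai].
  by rewrite -(inj_eq (@inc_inj n i)) inc_dec.
by case: eqP => // ab; rewrite ab inc_gt0 in ai.
Qed.

Lemma Mzi0 i : Mzi i ((fun=> 0) : fn R n) = (fun=> 0).
Proof. by apply/funext => a; rewrite /Mzi if_same. Qed.

(** * The adjoints on coefficients and the projection *)

Section Adjoint.
Variable Ms : 'I_n -> fn R n -> fn R n.
Hypothesis hMs : is_adj_Mzi m Ms.

Lemma inH_Ms i f : inH m f -> inH m (Ms i f).
Proof. by case: (hMs i) => H _; exact: H. Qed.

(** Testing the adjoint against z^b, which M_{z_i} sends to z^(b + e_i), isolates one coefficient on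
    each side. *)
Lemma MsE i g b : inH m g ->
  Ms i g b = Cof (rho b / rho (inc i b)) * g (inc i b).
Proof.
move=> Hg; have [_ /(_ _ _ (inH_mono b 1) Hg)] := hMs i.
rewrite Mzi_mono (ip_monol _ _ Hg) (ip_monol _ _ (inH_Ms i Hg)) !mul1r.
have Cr a : Cof (rho a) != 0 by rewrite Cof_eq0 rho_neq0.
move=> eq_ip; apply: (can_inj (@conjcK R)); rewrite conjM conj_Cof CofM CofV.
by rewrite mulrAC -mulrA eq_ip mulrCA divff // mulr1.
Qed.

(** By [rho_inc] the i-th summand carries the factor a_i / (m + deg a - 1), and the a_i add up to
    [deg a]. *)
Lemma Mz_Ms g a : inH m g ->
  Mz (fun i => Ms i g) a = Cof ((deg a)%:R / (m + deg a - 1)%:R) * g a.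
Proof.
move=> Hg; rewrite /Mz; under eq_bigr => i _.
  rewrite (_ : Mzi _ _ _ = Cof ((a i)%:R / (m + deg a - 1)%:R) * g a); first over.
  rewrite /Mzi; case: ifP => [ai|/negbT]; last first.
    by rewrite lt0n negbK => /eqP ->; rewrite mul0r -[Cof 0]/(0 : C) mul0r.
  rewrite MsE // rho_inc inc_dec // ffunE eqxx prednK //.
  by rewrite -(deg_dec ai) addnS subn1.
rewrite -mulr_suml -(big_morph _ CofD (erefl : Cof 0 = 0 :> C)).
by rewrite -mulr_suml -natr_sum.
Qed.

Lemma Ms_mono i a :
  Ms i (mono a 1) = if (0 < a i)%N then mono (dec i a) (Cof (rho (dec i a) / rho a))
                    else fun=> 0.
Proof.
apply/funext => b; rewrite MsE; last exact: inH_mono.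
rewrite /mono; case: eqP => [<-|ne]; first by rewrite inc_gt0 dec_inc eqxx mulr1.
rewrite mulr0; case: ifP => // ai; case: eqP => // bE; case: ne.
by rewrite bE inc_dec.
Qed.

(** [Ms i] never reads the constant coefficient. *)
Lemma eq_Ms i f g : inH m f -> inH m g ->
  (forall a, (0 < deg a)%N -> f a = g a) -> Ms i f = Ms i g.
Proof.
by move=> Hf Hg fg; apply/funext => b; rewrite !MsE // fg // deg_inc.
Qed.

Section ProjectionOntoRange.
Variable P : ('I_n -> fn R n) -> 'I_n -> fn R n.
Hypothesis hP : is_projImMzs m Ms P.

(** F - P F is orthogonal to the range of M_z^*, hence in the kernel of M_z; testing against M_z^*
    z^a gives the coefficient at [a]. *)
Lemma Mz_P F a : inHn m F -> Mz (P F) a = Mz F a.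
Proof.
move=> HF; have [HPF _ /(_ (mono a 1))] := hP HF.
have H1 : inH m (mono a 1) by exact: inH_mono.
move=> /(_ H1); rewrite /ipn; under eq_bigr => i _.
  rewrite (_ : ip _ _ _ = (Mzi i (F i) a - Mzi i (P F i) a) / Cof (rho a)).
    over.
  rewrite Ms_mono /Mzi; case: ifP => ai; last by rewrite ip0r subrr mul0r.
  rewrite ip_monor; last exact/inH_add/inH_scale.
  rewrite conj_Cof /Defs.addf /scalef mulN1r CofM CofV -!mulrA [X in _ * X]mulrC -!mulrA.
  by rewrite mulVf ?mulr1 // Cof_eq0 rho_neq0.
rewrite -mulr_suml => /eqP; rewrite mulf_eq0 invr_eq0 Cof_eq0 (negPf (rho_neq0 a)).
by rewrite orbF big_split sumrN /= subr_eq0 /Mz => /eqP ->.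
Qed.

(** Write the projection as M_z^* g. By [Mz_P], M_z M_z^* takes the same value on [g] and [f]; its
    factor is nonzero in positive degree, and constants are invisible to M_z^*. *)
Lemma P_Ms f : inH m f -> P (fun i => Ms i f) = (fun i => Ms i f).
Proof.
move=> Hf; have HF : inHn m (fun i => Ms i f) by move=> i; exact: inH_Ms.
have [_ [g Hg PE] _] := hP HF; rewrite PE; apply/funext => i.
apply: eq_Ms => // a a0; have := Mz_P a HF; rewrite PE !Mz_Ms //.
apply: mulfI; rewrite Cof_eq0 mulf_neq0 ?invr_eq0 ?pnatr_eq0 -?lt0n //.
by have := hm; lia.
Qed.

End ProjectionOntoRange.

(** The adjoint of delta M_z is M_z^* delta, [delta] being real and diagonal. The test tuple [F] has
    z^b in place [i] and 0 elsewhere. *)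
Lemma MpsE (Mps : fn R n -> 'I_n -> fn R n) g i : is_adj_Mz' m Mps -> inH m g ->
  Mps g i = Ms i (delta m g).
Proof.
move=> [HMps adj] Hg; apply/funext => b.
rewrite MsE; last exact: inH_delta.
pose F k := if k == i then mono b 1 else (fun=> 0 : C).
have HF : inHn m F.
  by move=> k; rewrite /F; case: eqP => _; [exact: inH_mono | exact: inH0].
have MzF : Mz' m F = mono (inc i b) (Cof (delta_coef (deg (inc i b)))).
  apply/funext => a; rewrite /Mz' deltaE /Mz (bigD1 i) //= /F eqxx Mzi_mono.
  rewrite big1 => [|k /negPf ->]; last by rewrite Mzi0.
  by rewrite addr0 /mono; case: eqP => [->|_]; rewrite ?mulr1 ?mulr0.
have := adj _ _ HF Hg; rewrite MzF ip_monol // /ipn (bigD1 i) //= big1; last first.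
  by move=> k /negPf ki; rewrite /F ki ip0l.
rewrite /F eqxx ip_monol; last exact: HMps.
rewrite mul1r addr0 => eq_ip; have Cr a : Cof (rho a) != 0 by rewrite Cof_eq0 rho_neq0.
apply: (can_inj (@conjcK R)); rewrite deltaE !conjM !conj_Cof CofM CofV.
by rewrite mulrAC -mulrA eq_ip mulrCA divff // mulr1.
Qed.

Lemma inH_sigma (X : fn R n -> fn R n) :
  (forall f, inH m f -> inH m (X f)) -> forall f, inH m f -> inH m (sigma Ms X f).
Proof.
move=> HX f Hf; apply: (inH_sum _ (F := fun i => Mzi i (X (Ms i f)))) => i.
exact/inH_Mzi/HX/inH_Ms.
Qed.

Lemma inH_iter_sigma (X : fn R n -> fn R n) j :
  (forall f, inH m f -> inH m (X f)) ->
  forall f, inH m f -> inH m (iter j (sigma Ms) X f).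
Proof. by move=> HX; elim: j => //= j IH; exact: inH_sigma. Qed.

Lemma inH_Sop (X : fn R n -> fn R n) :
  (forall f, inH m f -> inH m (X f)) -> forall f, inH m f -> inH m (Sop m Ms X f).
Proof.
move=> HX f Hf; apply: (inH_sum _ (F := fun j : 'I_m => fun a =>
  (-1) ^+ j * 'C(m, j.+1)%:R * iter j (sigma Ms) X f a)) => j.
exact/inH_scale/inH_iter_sigma.
Qed.

(** Placing X between M_z and M_z^* is one more [sigma]: the power moves from j to j + 1 and so
    matches the binomial. *)
Lemma Mz_Sop (X : fn R n -> fn R n) f a :
  Mz (fun i => Sop m Ms X (Ms i f)) a =
  \sum_(j < m) (-1) ^+ j * 'C(m, j.+1)%:R * iter j.+1 (sigma Ms) X f a.
Proof.
under [RHS]eq_bigr do rewrite iterS /sigma mulr_sumr.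
rewrite exchange_big; apply: eq_bigr => i _; rewrite /Mzi.
case: ifP => ai; first by apply: eq_bigr.
by rewrite big1 // => j _; rewrite mulr0.
Qed.

(** Each [sigma] ends with a multiplication by some z_i, so it reads output coefficients one degree
    lower and gains one degree of agreement. *)
Lemma eq_iter_sigma d (X Y : fn R n -> fn R n) :
  (forall f a, inH m f -> (deg a < d)%N -> X f a = Y f a) ->
  forall j f a, inH m f -> (deg a < d + j)%N ->
    iter j (sigma Ms) X f a = iter j (sigma Ms) Y f a.
Proof.
move=> XY; elim=> [|j IH] f a Hf; first by rewrite addn0; exact: XY.
move=> ad; apply: eq_bigr => i _; rewrite /Mzi; case: ifP => // ai.
by apply: IH; [exact: inH_Ms | have := deg_dec ai; lia].
Qed.

End Adjoint.

(** * Constant terms, and tails of small norm *)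

Local Notation mi0 := ([ffun=> 0%N] : mi n).

Lemma deg_mi0 : deg mi0 = 0%N.
Proof. by apply: big1 => i _; rewrite ffunE. Qed.

Lemma onefnE : @onefn R n = mono mi0 1.
Proof.
apply/funext => a; rewrite /onefn /mono; case: eqP => [/deg_eq0 ->|a0].
  by rewrite eqxx.
by case: eqP => // aE; rewrite aE deg_mi0 in a0.
Qed.

Lemma mono_zer b f : f = addf (scalef (f b) (mono b 1)) (zer b f).
Proof.
apply/funext => a; rewrite /Defs.addf /scalef /mono /zer.
by case: eqP => [->|_]; rewrite ?mulr1 ?mulr0 ?addr0 ?add0r.
Qed.

Lemma normsq_foldr_zer f (s : seq (mi n)) : inH m f -> uniq s ->
  inH m (foldr zer f s) /\
  normsq m f = \sum_(b <- s) abs2 (f b) / rho b + normsq m (foldr zer f s).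
Proof.
move=> Hf; elim: s => [|b s IH] /=; first by rewrite big_nil add0r.
move=> /andP[bs /IH[Hs ->]]; split; first exact: inH_zer.
have fsb : foldr zer f s b = f b.
  elim: s bs {IH Hs} => //= c s IH; rewrite inE negb_or => /andP[bc /IH].
  by rewrite /zer (negPf bc).
by rewrite big_cons (normsq_zer b Hs) fsb addrCA addrA.
Qed.

(** The norm is a supremum over finite sets of indices; deleting the coefficients of a nearly
    optimal set leaves a small tail. *)
Lemma normsq_foldr_zer_small f (e : R) : inH m f -> 0 < e ->
  exists s, inH m (foldr zer f s) /\ normsq m (foldr zer f s) < e.
Proof.
move=> Hf e0.
have fin : wsum m f \is a fin_num by rewrite wsumE.
have [_ [X [finX _] <-]] := ub_ereal_sup_adherent e0 fin.
rewrite fsbig_finite // -/(esum _ _) -/(wsum m f) (wsumE Hf)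
  sumEFin -EFinB lte_fin => lt_sum.
exists (finmap.enum_fset (fset_set X)).
have [Hs] := normsq_foldr_zer Hf (finmap.fset_uniq (fset_set X)).
by split=> //; lra.
Qed.

(** * The constant term of T f *)

Section Homogeneous.
Variables (r : nat) (T : fn R n -> fn R n).
Hypothesis hT : isOp m T.
Hypothesis homT : forall j f, inH m f -> homog j f -> homog (j + r)%N (T f).

Lemma T_lin c f g a : inH m f -> inH m g ->
  T (addf (scalef c f) g) a = c * T f a + T g a.
Proof. by case: hT => _ lin _ Hf Hg; rewrite lin. Qed.

(** For b != 0, homogeneity sends z^b to degree deg b + r > 0, away from the constant term. *)
Lemma T_zer b f : inH m f -> f mi0 = 0 -> T f mi0 = T (zer b f) mi0.
Proof.
move=> Hf f0; have H1 : inH m (mono b 1) by exact: inH_mono.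
rewrite {1}(mono_zer b f) T_lin //; last exact: inH_zer.
have [->|b0] := eqVneq b mi0; first by rewrite f0 mul0r add0r.
rewrite (homT (j := deg b)) ?mulr0 ?add0r //; last first.
  rewrite deg_mi0 eq_sym addn_eq0; apply: contra b0 => /andP[/eqP/deg_eq0 -> _].
  by [].
by move=> a ab; rewrite /mono; case: (a =P b) ab => // ->; rewrite eqxx.
Qed.

(** Deleting finitely many coefficients of [f] does not change the constant term of T f, while
    boundedness makes it arbitrarily small. *)
Lemma T_vanish f : inH m f -> f mi0 = 0 -> T f mi0 = 0.
Proof.
move=> Hf f0; have [HT _ [K HK]] := hT.
have Hs s : [/\ inH m (foldr zer f s), foldr zer f s mi0 = 0
               & T f mi0 = T (foldr zer f s) mi0].
  elim: s => // b s [IH1 IH2 IH3]; split; first exact: inH_zer.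
    by rewrite /= /zer IH2 if_same.
  by rewrite IH3 /= -T_zer.
apply: abs2_eq0; apply/eqP; rewrite eq_le abs2_ge0 andbT leNgt; apply/negP.
set v := abs2 _ => v0.
(* The bound [K] may have any sign, so |K| + 1 replaces it; [rho mi0] is the weight of the constant
   term in the norm. *)
have K1 : 0 < rho mi0 * (`|K| + 1) by rewrite mulr_gt0 ?rho_gt0 ?ltr_wpDl.
have [s [Hfs lt_e]] := normsq_foldr_zer_small Hf (divr_gt0 v0 K1).
have [_ _ TE] := Hs s.
have Tv : v / rho mi0 <= K * normsq m (foldr zer f s).
  apply: le_trans (HK _ Hfs); rewrite (normsq_zer mi0 (HT _ Hfs)) -TE lerDl.
  exact: normsq_ge0.
move: lt_e; rewrite ltr_pdivlMr // => lt_v; move: Tv.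
rewrite ler_pdivrMr ?rho_gt0 // leNgt => /negP; apply; apply: le_lt_trans lt_v.
rewrite -mulrA mulrC -mulrA ler_wpM2l ?normsq_ge0 //.
rewrite ler_wpM2l ?ltW ?rho_gt0 //.
by have := ler_norm K; lra.
Qed.

End Homogeneous.

(** * Alternating binomial sums and the eigenvalues of sigma^j(id) *)

Section BinomialSums.
Variable F : comNzRingType.

(** By Pascal's rule, a difference of order k + 1 is one of order k of first differences. *)
Lemma alternating_binomialS k (X : nat -> F) :
  \sum_(j < k.+2) (-1) ^+ j * 'C(k.+1, j)%:R * X j =
  \sum_(j < k.+1) (-1) ^+ j * 'C(k, j)%:R * (X j - X j.+1).
Proof.
rewrite big_ord_recl /= !bin0.
under eq_bigr => j _.
  rewrite /bump /= add1n binS natrD mulrDr mulrDl.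
  over.
rewrite big_split /= addrA big_ord_recr /= bin_small // mulr0 mul0r addr0.
under [RHS]eq_bigr do rewrite mulrBr.
rewrite big_split /= -(bin0 k) -(big_ord_recl _ (fun j => (-1) ^+ j * 'C(k, j)%:R * X j)).
congr (_ + _); apply: eq_bigr => j _; rewrite exprS; ring.
Qed.

(** A k-th difference kills polynomials of degree p < k in j; k <= N keeps the subtraction N - j
    exact. *)
Lemma alternating_binomial_eq0 k N p : (p < k <= N)%N ->
  \sum_(j < k.+1) (-1) ^+ j * 'C(k, j)%:R * 'C(N - j, p)%:R = 0 :> F.
Proof.
elim: k N p => // k IH [|N] p; first by rewrite ltn0 andbF.
rewrite !ltnS => /andP[pk kN].
rewrite (alternating_binomialS _ (fun j => 'C(N.+1 - j, p)%:R)).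
case: p pk => [|p] pk; first by rewrite big1 // => j _; rewrite !bin0 subrr mulr0.
rewrite -[RHS](IH N p) ?pk //; apply: eq_bigr => j _; congr (_ * _).
have jN : (j <= N)%N by apply: leq_trans kN; rewrite -ltnS.
by rewrite subSS subSn // binS natrD [X in X - _]addrC addrK.
Qed.

End BinomialSums.

(* The eigenvalue of sigma^j(id) on homogeneous polynomials of degree k; the
   junk value k.-1 at k = 0 is killed by the factor k. *)
Fixpoint sigma_coef (j k : nat) : R :=
  if j is j'.+1 then k%:R / (m + k - 1)%:R * sigma_coef j' k.-1 else 1.

(** The product defining [sigma_coef] telescopes into a ratio of binomials. The bounds on [j] and
    [k] keep m + k - 1 - j from being truncated. *)
Lemma sigma_coefE j k : (j <= m)%N -> (0 < k)%N ->
  sigma_coef j k * 'C(m + k - 1, m - 1)%:R = 'C(m + k - 1 - j, m - 1)%:R.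
Proof.
elim: j k => [|j IH] k jm k0; first by rewrite mul1r subn0.
case: k k0 => // -[|k] _ /=.
  (* Here k = 1, where the recursion reaches k = 0, outside the induction hypothesis: one step gives
     1 / m, further steps give 0. *)
  case: j jm {IH} => [|j] jm /=.
    rewrite mulr1 addnK binn.
    case: m jm => // m' _; rewrite /= subn1 /= binSn; field.
    by rewrite nat1r pnatr_eq0.
  rewrite !(mul0r, mulr0) bin_small //; lia.
have -> : (m + k.+2 - 1 = (m + k).+1)%N by lia.
have -> : ((m + k).+1 - j.+1 = m + k.+1 - 1 - j)%N by lia.
rewrite -IH //; last by lia.
have -> : (m + k.+1 - 1 = m + k)%N by lia.
rewrite mulrAC [RHS]mulrC; congr (_ * _).
have H : (k.+2 * 'C((m + k).+1, m - 1) = (m + k).+1 * 'C(m + k, m - 1))%N.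
  by rewrite (mul_bin_down (m + k).+1); congr (_ * _)%N; lia.
by rewrite mulrAC -natrM H natrM mulrAC divff ?mul1r ?pnatr_eq0.
Qed.

(** After clearing the denominator, this is an m-th difference of a binomial of degree m - 1 in
    j. *)
Lemma sum_sigma_coef_eq0 k : (0 < k)%N ->
  \sum_(j < m.+1) (-1) ^+ j * 'C(m, j)%:R * sigma_coef j k = 0.
Proof.
move=> k0; have C0 : 'C(m + k - 1, m - 1)%:R != 0 :> R.
  by rewrite pnatr_eq0 -lt0n bin_gt0; lia.
apply: (mulIf C0); rewrite mul0r mulr_suml.
rewrite -[RHS](@alternating_binomial_eq0 _ m (m + k - 1) (m - 1)); last by lia.
by apply: eq_bigr => j _; rewrite -[_ * sigma_coef _ _ * _]mulrA sigma_coefE // -ltnS.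
Qed.

Lemma iter_sigma_id (Ms : 'I_n -> fn R n -> fn R n) j f a :
  is_adj_Mzi m Ms -> inH m f ->
  iter j (sigma Ms) id f a = Cof (sigma_coef j (deg a)) * f a.
Proof.
move=> hMs; elim: j f a => [|j IH] f a Hf; first by rewrite -[Cof _]/(1 : C) mul1r.
rewrite iterS CofM mulrAC -(Mz_Ms hMs) // mulrC /Mz mulr_sumr.
apply: eq_bigr => i _; rewrite /Mzi; case: ifP => ai; last by rewrite mulr0.
by rewrite IH; [rewrite -(deg_dec ai) | exact: inH_Ms].
Qed.

(* cprod sums over a box whose size depends on a; this allows any larger box. *)
Lemma cprodE (g f : fn R n) a N : (deg a <= N)%N ->
  cprod g f a = \sum_(b : {ffun 'I_n -> 'I_N.+1} | [forall i, (b i <= a i)%N])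
     g [ffun i => val (b i)] * f [ffun i => (a i - b i)%N].
Proof.
move=> aN; rewrite /cprod.
have small i : (a i < N.+1)%N by rewrite ltnS; exact: leq_trans (leq_deg a i) aN.
rewrite [RHS](reindex_onto
  (fun b : {ffun 'I_n -> 'I_(deg a).+1} => [ffun i => inord (b i)] : {ffun 'I_n -> 'I_N.+1})
  (fun b : {ffun 'I_n -> 'I_N.+1} => [ffun i => inord (b i)])); last first.
  move=> b /forallP ba; apply/ffunP => i; rewrite !ffunE; apply: val_inj.
  have bE : (inord (b i) : 'I_(deg a).+1) = b i :> nat.
    by rewrite inordK // ltnS; exact: leq_trans (ba i) (leq_deg a i).
  by rewrite /= bE inord_val.
have ordK (b : 'I_(deg a).+1) : (inord b : 'I_N.+1) = b :> nat.
  by rewrite inordK // (leq_trans (ltn_ord b)).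
apply: eq_big => [b|b _].
  rewrite [X in _ = _ && X](_ : _ = true) ?andbT; last first.
    apply/eqP/ffunP => i; rewrite !ffunE; apply: val_inj.
    by rewrite /= ordK inordK.
  by apply: eq_forallb => i; rewrite ffunE ordK.
by congr (g _ * f _); apply/ffunP => i; rewrite !ffunE /= ?ordK.
Qed.

(** Summands with b_i = a_i vanish on the left, since [Mzi i f] has no term free of z_i; the others
    match after lowering a_i. *)
Lemma cprod_Mzi (g f : fn R n) i : cprod g (Mzi i f) = Mzi i (cprod g f).
Proof.
apply/funext => a; rewrite /Mzi; case: ifP => ai; last first.
  rewrite /cprod big1 // => b /forallP ba; rewrite ffunE.
  rewrite (_ : (_ < _)%N = false) ?mulr0 //; have := ba i; lia.
rewrite (@cprodE g f (dec i a) (deg a)); last by rewrite -(deg_dec ai).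
rewrite /cprod big_mkcond [RHS]big_mkcond; apply: eq_bigr => b _.
have [bi|bi] := ltnP (b i) (a i); last first.
  rewrite (_ : [forall j, (b j <= dec i a j)%N] = false); last first.
    by apply/negbTE/forallPn; exists i; rewrite ffunE eqxx; lia.
  case: ifP => // /forallP ba; rewrite ffunE.
  by rewrite subn_gt0 ltnNge bi mulr0.
rewrite (_ : [forall j, (b j <= dec i a j)%N] = [forall j, (b j <= a j)%N]).
  case: ifP => // _; rewrite ffunE subn_gt0 bi; congr (_ * f _).
  by apply/ffunP => j; rewrite !ffunE; case: eqP => // ->; lia.
apply: eq_forallb => j; rewrite ffunE; case: eqP => // ->; lia.
Qed.

Lemma cprod_sum (I : Type) (s : seq I) (g : fn R n) (F : I -> fn R n) :
  cprod g (fun a => \sum_(k <- s) F k a) = fun a => \sum_(k <- s) cprod g (F k) a.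
Proof.
apply/funext => a; rewrite /cprod exchange_big; apply: eq_bigr => b _.
by rewrite mulr_sumr.
Qed.

Lemma cprod_scale c (g f : fn R n) a : cprod g (scalef c f) a = c * cprod g f a.
Proof. by rewrite /cprod mulr_sumr; apply: eq_bigr => b _; rewrite mulrCA. Qed.

Lemma cprod_mono0 (g : fn R n) c : cprod g (mono mi0 c) = scalef c g.
Proof.
apply/funext => a; rewrite /cprod.
have aa i : (inord (a i) : 'I_(deg a).+1) = a i :> nat.
  by rewrite inordK // ltnS leq_deg.
(* Only b = a leaves exponent 0 for the second factor; [inord] places it in the box. *)
rewrite (bigD1 [ffun i => inord (a i)]) /=; last first.
  by apply/forallP => i; rewrite ffunE aa.
rewrite big1 ?addr0 => [|b /andP[/forallP ba ne]]; last first.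
  rewrite /mono; case: eqP => [/ffunP b0|_]; last by rewrite mulr0.
  case/eqP: ne; apply/ffunP => i; rewrite ffunE; apply: val_inj; rewrite /= aa.
  by apply/eqP; rewrite eqn_leq ba -subn_eq0; have := b0 i; rewrite !ffunE => ->.
rewrite /mono [X in X == _](_ : _ = mi0) ?eqxx; last first.
  by apply/ffunP => i; rewrite !ffunE aa subnn.
rewrite mulrC /scalef; congr (_ * g _); apply/ffunP => i.
by rewrite !ffunE aa.
Qed.

Lemma cprod_mi0 (g f : fn R n) : cprod g f mi0 = g mi0 * f mi0.
Proof.
transitivity (cprod g (mono mi0 (f mi0)) mi0).
  apply: eq_bigr => b _; rewrite (_ : [ffun i => (mi0 i - b i)%N] = mi0) /mono ?eqxx //.
  by apply/ffunP => i; rewrite !ffunE sub0n.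
by rewrite cprod_mono0 mulrC.
Qed.

(** Multiplication by [g] commutes with each M_{z_i}, so it moves out of every [sigma]. *)
Lemma iter_sigma_cprod (Ms : 'I_n -> fn R n -> fn R n) g j f :
  iter j (sigma Ms) (cprod g) f = cprod g (iter j (sigma Ms) id f).
Proof.
elim: j f => // j IH f; rewrite !iterS /sigma cprod_sum.
by apply/funext => a; apply: eq_bigr => i _; rewrite cprod_Mzi IH.
Qed.

(** * The operator identity and the induction on degree *)

Section MainEquation.
Variables (r : nat) (T : fn R n -> fn R n) (Ms : 'I_n -> fn R n -> fn R n).
Variables (Mps : fn R n -> 'I_n -> fn R n) (P : ('I_n -> fn R n) -> 'I_n -> fn R n).
Hypothesis hT : isOp m T.
Hypothesis homT : forall j f, inH m f -> homog j f -> homog (j + r)%N (T f).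
Hypothesis hMs : is_adj_Mzi m Ms.
Hypothesis hMps : is_adj_Mz' m Mps.
Hypothesis hP : is_projImMzs m Ms P.
Hypothesis hTeq : forall F, inHn m F ->
  Mps (T (Mz' m F)) = P (fun i => Sop m Ms T (P F i)).

Lemma T_split0 f a : inH m f -> T f a = f mi0 * T (@onefn R n) a + T (zer mi0 f) a.
Proof.
move=> Hf; rewrite {1}(mono_zer mi0 f) (T_lin hT) ?onefnE //.
  exact: inH_mono.
exact: inH_zer.
Qed.

Lemma defect_T f a : inH m f -> (0 < deg a)%N ->
  \sum_(j < m.+1) (-1) ^+ j * 'C(m, j)%:R * iter j (sigma Ms) T f a =
  f mi0 * T (@onefn R n) a.
Proof.
move=> Hf a0; have [HT _ _] := hT.
have HF : inHn m (fun i => Ms i f) by move=> i; exact: inH_Ms.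
(* [delta] cancels the factor of M_z M_z^* in positive degree, and the constant term is lost. *)
have Mz'F : Mz' m (fun i => Ms i f) = zer mi0 f.
  apply/funext => b; rewrite /Mz' deltaE Mz_Ms // mulrA -CofM /zer.
  case: eqP => [->|b0]; first by rewrite deg_mi0 mul0r mulr0 -[Cof 0]/(0 : C) mul0r.
  have b1 : (0 < deg b)%N by rewrite lt0n; apply/eqP => /deg_eq0.
  rewrite /delta_coef gtn_eqF // [X in Cof X](_ : _ = 1) -?[Cof 1]/(1 : C) ?mul1r //.
  by field; rewrite !pnatr_eq0 -!lt0n b1 /=; have := hm; lia.
have HTz : inH m (T (zer mi0 f)) by exact/HT/inH_zer.
(* Under M_z both projections disappear: the inner one fixes M_z^* f, the outer one changes only the
   kernel of M_z. *)
have := congr1 (fun F => Mz F a) (hTeq HF).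
rewrite (P_Ms hMs hP Hf) (Mz_P hMs hP) => [|i]; last exact/inH_Sop/inH_Ms.
rewrite Mz_Sop Mz'F (_ : Mps _ = fun i => Ms i (delta m (T (zer mi0 f)))); last first.
  by apply/funext => i; rewrite (MpsE hMs _ hMps).
rewrite (Mz_Ms hMs) ?deltaE ?mulrA -?CofM; last exact: inH_delta.
rewrite (_ : _ / _ * _ = 1); last first.
  rewrite /delta_coef gtn_eqF //.
  by field; rewrite !pnatr_eq0 -!lt0n a0 /=; have := hm; lia.
(* The identity expresses T(f - f_0) by the terms with j >= 1 of opposite sign, leaving f_0 T1 from
   the term j = 0. *)
rewrite -[Cof 1]/(1 : C) mul1r big_ord_recl mul1r bin0 mul1r /= (T_split0 _ Hf) => ->.
rewrite -addrA -big_split big1 ?addr0 // => j _ /=.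
by rewrite exprS /bump add1n; ring.
Qed.

Lemma T_mulE f : inH m f -> T f = cprod (T (@onefn R n)) f.
Proof.
move=> Hf; set g := T (@onefn R n); apply/funext => a.
(* [f] stays general in the induction because [sigma] replaces it by M_{z_i}^* f. *)
have [d] := ubnP (deg a); elim: d f a Hf => // d IH f a Hf ad.
have [a0|a0] := posnP (deg a).
  rewrite (deg_eq0 a0) (T_split0 _ Hf) (T_vanish hT homT (inH_zer _ Hf)).
    by rewrite addr0 cprod_mi0 mulrC.
  by rewrite /zer eqxx.
have := defect_T Hf a0; rewrite big_ord_recl mul1r bin0 mul1r /= => TE.
have eq_sum : \sum_(j < m) (-1) ^+ lift ord0 j * 'C(m, lift ord0 j)%:R *
    iter (lift ord0 j) (sigma Ms) T f a =
  \sum_(j < m) (-1) ^+ lift ord0 j * 'C(m, lift ord0 j)%:R *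
    iter (lift ord0 j) (sigma Ms) (cprod g) f a.
  apply: eq_bigr => j _; congr (_ * _).
  have IHd f' a' : inH m f' -> (deg a' < d)%N -> T f' a' = cprod g f' a' by exact: IH.
  by apply: (eq_iter_sigma hMs IHd Hf); rewrite /= /bump add1n; lia.
(* Pulling [g] out leaves the alternating sum of sigma^j(id), which is f |-> f_0. *)
have cE : \sum_(j < m.+1) (-1) ^+ j * 'C(m, j)%:R * iter j (sigma Ms) (cprod g) f a =
    f mi0 * g a.
  under eq_bigr do rewrite iter_sigma_cprod -cprod_scale.
  transitivity (cprod g (mono mi0 (f mi0)) a); last by rewrite cprod_mono0.
  rewrite -(congr1 (fun F => F a) (cprod_sum _ _ _)); congr (cprod g _ a).
  apply/funext => b; rewrite /scalef.
  under eq_bigr do rewrite iter_sigma_id // mulrA.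
  rewrite -mulr_suml /mono; case: eqP => [->|b0].
    rewrite deg_mi0 big_ord_recl /= big1 => [|j _]; last first.
      by rewrite mul0r mul0r -[Cof 0]/(0 : C) mulr0.
    by rewrite expr0 bin0 -[Cof 1]/(1 : C) !mulr1 addr0 mul1r.
  have b1 : (0 < deg b)%N by rewrite lt0n; apply/eqP => /deg_eq0.
  have := congr1 (@Cof R) (sum_sigma_coef_eq0 b1).
  rewrite (big_morph _ CofD (erefl : Cof 0 = 0 :> C)) -[Cof 0]/(0 : C).
  under eq_bigr => j _.
    rewrite !CofM Cof_nat (_ : Cof _ = (-1) ^+ j); first over.
    elim: (nat_of_ord j) => [|k IHk]; first by [].
    rewrite !exprS CofM IHk; congr (_ * _).
    by rewrite /Cof; apply/eqP; rewrite eq_complex /= oppr0 !eqxx.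
  by move=> ->; rewrite mul0r.
move: TE cE; rewrite -/g eq_sum [X in _ -> X = _ -> _]big_ord_recl mul1r bin0 mul1r /=.
by move=> <- /addIr.
Qed.

End MainEquation.

End Space.

Theorem theorem3 (R : realType) (n m : nat) (hn : (1 <= n)%N) (hm : (1 <= m)%N)
  (r : nat) (T : fn R n -> fn R n)
  (Ms : 'I_n -> fn R n -> fn R n)
  (Mps : fn R n -> 'I_n -> fn R n)
  (P : ('I_n -> fn R n) -> 'I_n -> fn R n) :
  isOp m T ->
  (forall j f, inH m f -> homog j f -> homog (j + r) (T f)) ->
  is_adj_Mzi m Ms ->
  is_adj_Mz' m Mps ->
  is_projImMzs m Ms P ->
  (forall F, inHn m F ->
     Mps (T (Mz' m F)) = P (fun i => Sop m Ms T (P F i))) ->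
  forall f, inH m f -> T f = cprod (T (@onefn R n)) f.
Proof.
move=> hT homT hMs hMps hP hTeq; exact: (T_mulE hm hT homT hMs hMps hP hTeq).
Qed.
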